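(* Let $N\ge1$, $p>1$ and $\beta>-2$. There exists a constant $\tilde c=\tilde c(N,p,\beta)$ such that any solution $u$ of $$\partial_tu-\Delta u+|x|^\beta|u|^{p-1}u=0\quad\text{in }Q_T$$ which verifies $\lim_{t\to0}u(x,t)=0$ for all $x\ne0$ satisfies $$|u(x,t)|\le\frac{\tilde c}{(|x|^2+t)^{(2+\beta)/(2(p-1))}}\qquad\forall(x,t)\in Q_T.$$
   Context: $Q_T=\mathbb{R}^N\times(0,T)$ with $T>0$. By a solution of the equation in $Q_T$ is meant a function $u\in C^{2,1}(Q_T)$.
   Formalization: The condition lim u(x,t)=0 as t→0 for x≠0 is taken locally uniformly off the origin (joint limit in (x,t)); with pointwise limits the bound fails, e.g. N=1, β=0, 1<p<2, initial datum a derivative of a Dirac mass at x0≠0. *)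

(* Defs.v *)
From HB Require Import structures.
From mathcomp Require Import all_boot all_order all_algebra.
From mathcomp Require Import all_classical all_reals all_analysis.

Set Implicit Arguments.
Unset Strict Implicit.
Unset Printing Implicit Defensive.

Import Order.TTheory GRing.Theory Num.Theory.
Import numFieldNormedType.Exports.

Local Open Scope classical_set_scope.
Local Open Scope ring_scope.

(* The canonical norm `|x| on 'rV[R]_N is the sup norm, not the Euclidean one
   (the topology is the same). *)
Definition enorm (R : realType) (N : nat) (x : 'rV[R]_N) : R :=
  Num.sqrt (\sum_(i < N) x ord0 i ^+ 2).

Definition QT (R : realType) (N : nat) (T : R) : set ('rV[R]_N * R) :=
  [set z | 0 < z.2 < T].

Definition evec (R : realType) (N : nat) (i : 'I_N) : 'rV[R]_N :=
  delta_mx ord0 i.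

Definition dt (R : realType) (N : nat) (u : 'rV[R]_N -> R -> R) :
    'rV[R]_N -> R -> R :=
  fun x t => 'D_1 (u x) t.

Definition dx (R : realType) (N : nat) (i : 'I_N) (u : 'rV[R]_N -> R -> R) :
    'rV[R]_N -> R -> R :=
  fun x t => 'D_(evec R i) (fun y => u y t) x.

Definition laplacian (R : realType) (N : nat) (u : 'rV[R]_N -> R -> R) :
    'rV[R]_N -> R -> R :=
  fun x t => \sum_(i < N) dx i (dx i u) x t.

Definition continuous_Q (R : realType) (N : nat) (T : R)
    (f : 'rV[R]_N -> R -> R) : Prop :=
  {in QT T, continuous (fun z : 'rV[R]_N * R => f z.1 z.2)}.

(* 'D_v is total, so the existence of each derivative is required explicitly. *)
Definition C21 (R : realType) (N : nat) (T : R) (u : 'rV[R]_N -> R -> R) :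
    Prop :=
  [/\ continuous_Q T u,
      (forall x t, QT T (x, t) -> derivable (u x) t 1) /\
        continuous_Q T (dt u),
      (forall i x t, QT T (x, t) ->
         derivable (fun y => u y t) x (evec R i)) /\
        (forall i, continuous_Q T (dx i u)) &
      (forall i j x t, QT T (x, t) ->
         derivable (fun y => dx i u y t) x (evec R j)) /\
        (forall i j, continuous_Q T (dx j (dx i u)))].

(* If beta < 0 the weight |x|^beta is undefined at x = 0 (whereas powR gives
   the value 0), so there the equation is imposed only where x != 0; the
   regularity C^{2,1} is still required on all of Q_T. *)
Definition solution (R : realType) (N : nat) (T p beta : R)
    (u : 'rV[R]_N -> R -> R) : Prop :=
  C21 T u /\
  forall x t, QT T (x, t) -> (0 <= beta \/ x != 0) ->
    dt u x t - laplacian u x t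
      + enorm x `^ beta * (`|u x t| `^ (p - 1) * u x t) = 0.

(* u(y, t) -> 0 as (y, t) -> (x, 0) within Q_T, for every x <> 0; equivalently,
   u(., t) -> 0 as t -> 0, locally uniformly on R^N \ {0}.  With the limit taken
   at each fixed x only, the estimate fails for sign-changing solutions: for
   beta = 0 and 1 < p < 1 + 2 / (N + 1), the solution whose initial datum is a
   first derivative of the Dirac mass at some x0 <> 0 tends to 0 at every fixed
   x, but is unbounded near (x0, 0). *)
Definition vanishes_initially (R : realType) (N : nat) (T : R)
    (u : 'rV[R]_N -> R -> R) : Prop :=
  forall x : 'rV[R]_N, x != 0 ->
    (fun z : 'rV[R]_N * R => u z.1 z.2) @ within (QT T) (nbhs (x, 0 : R))
      --> (0 : R).

(* Main.v *)
Require Import Defs.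
From HB Require Import structures.
From mathcomp Require Import all_boot all_order all_algebra.
From mathcomp Require Import all_classical all_reals all_analysis.
From mathcomp Require Import lra ring.

Set Implicit Arguments.
Unset Strict Implicit.
Unset Printing Implicit Defensive.

Import Order.TTheory GRing.Theory Num.Theory.
Import numFieldNormedType.Exports.

Local Open Scope classical_set_scope.
Local Open Scope ring_scope.

(** Both [u] and [- u] are subsolutions wherever they are positive, so an upper
    bound for subsolutions [w] suffices. All comparisons are with barriers
    [M s^-k], [s = a0 + b t + c |x - y|^2], at a point where [w s^k] is maximal.
    On the ball of radius [|x0| / 2] around [x0], [s = |x0|^2 / 4 - |x - x0|^2]
    and [k = 2 / (p - 1)] give the Keller-Osserman type bound
    [w(x0, t) <= C |x0|^(-2 gamma)], [gamma = (2 + beta) / (2 (p - 1))], uniform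
    in time because [w] vanishes initially away from the origin. It gives the
    claim when [|x|^2] is at least a multiple of [t]; in the remaining paraboloid
    it controls the lateral boundary, and
    [s = t - t0 / 2 + |x|^2], [k = gamma] gives a supersolution of the heat
    equation alone. *)

(** * One-variable derivative tests at a maximum *)

Lemma is_derive_quotient (R : realType) (f : R -> R) (x l : R) :
  is_derive x 1 f l -> h^-1 * (f (h + x) - f x) @[h --> (0:R)^'] --> l.
Proof.
move=> [df <-]; have := df; rewrite /derivable => /cvg_ex[l' hl'].
have -> : 'D_1 f x = l' by rewrite /derive; exact: cvg_lim.
apply: cvg_trans hl'; apply: near_eq_cvg; near=> h.
by rewrite /= /GRing.scale/= mulr1.
Unshelve. all: by end_near.
Qed.

(** One-sided because a maximum over a space-time region may sit at its final time, where only
    earlier times are available. *)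
Lemma left_max_derive_ge0 (R : realType) (f : R -> R) (x l : R) :
  is_derive x 1 f l -> (\forall h \near (0:R)^'-, f (h + x) <= f x) -> 0 <= l.
Proof.
move=> /is_derive_quotient/cvg_dnbhs_at_left fl fle.
apply: (cvgr_to_ge fl).
near=> h.
have h0 : h < 0 by near: h; exact: nbhs_left_lt.
rewrite nmulr_rge0 ?invr_lt0// subr_le0.
by near: h.
Unshelve. all: by end_near.
Qed.

(* If the second derivative at the maximum were positive, the first one would
   be positive to the right of it and the mean value theorem would contradict
   maximality. *)
Lemma max_second_derive_le0 (R : realType) (f g : R -> R) (x l : R) :
  (\forall y \near x, is_derive y (1 : R) f (g y)) -> is_derive x 1 g l ->
  (\forall y \near x, f y <= f x) -> l <= 0.
Proof.
move=> fg gl fle; rewrite leNgt; apply/negP => l0.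
have [e/= e0 He] : exists2 e, 0 < e & forall y, `|x - y| < e ->
    is_derive y (1 : R) f (g y) /\ f y <= f x.
  have : \forall y \near x, is_derive y (1 : R) f (g y) /\ f y <= f x.
    by near=> y; split; near: y.
  by move=> /nbhs_ballP[e/= e0 He]; exists e => // y xy; exact: He.
have g0 : g x = 0.
  have dfx : is_derive x 1 f 0.
    apply: (@derive1_at_max _ f (x - e) (x + e)).
    - lra.
    - move=> t; rewrite in_itv/= => /andP[t1 t2].
      by have [|[? _] _] := He t; [rewrite ltr_norml; lra|].
    - by rewrite in_itv/=; lra.
    - move=> t; rewrite in_itv/= => /andP[t1 t2].
      by have [|] := He t; [rewrite ltr_norml; lra|].
  have [|dfx' _] := He x; first by rewrite subrr normr0.
  by rewrite -(@derive_val _ _ _ _ _ _ _ dfx') (@derive_val _ _ _ _ _ _ _ dfx).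
have [d/= d0 Hd] : exists2 d, 0 < d & forall h, 0 < h < d -> 0 < g (h + x).
  have : \forall h \near (0:R)^', 0 < h^-1 * (g (h + x) - g x).
    exact: (cvgr_gt _ (is_derive_quotient gl)).
  rewrite near_withinE => /nbhs_ballP[d/= d0 Hd].
  exists d => // h /andP[h0 hd]; have := Hd h.
  rewrite g0 subr0 pmulr_rgt0 ?invr_gt0//; apply; last by rewrite gt_eqF.
  by rewrite /ball/= sub0r normrN gtr0_norm.
pose h := Num.min d e / 2.
have [h0 hd he] : [/\ 0 < h, h < d & h < e].
  have : 0 < Num.min d e by rewrite lt_min d0.
  have : Num.min d e <= d by rewrite ge_min lexx.
  have : Num.min d e <= e by rewrite ge_min lexx orbT.
  by rewrite /h; split; lra.
have Dd y : y \in `[x, x + h] -> is_derive y (1 : R) f (g y).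
  by rewrite in_itv/= => yx; have [|] := He y => //; rewrite ltr_norml; lra.
have xh : x < x + h by rewrite ltrDl.
have cf : {within `[x, x + h], continuous f}.
  by apply: derivable_within_continuous => y /Dd[].
have Doo y : y \in `]x, x + h[ -> is_derive y (1 : R) f (g y).
  by move=> yx; apply: Dd; exact: subset_itv_oo_cc yx.
have [y yx fE] := MVT xh Doo cf.
rewrite in_itv/= in yx.
have [|_ fxh] := He (x + h); first by rewrite ltr_norml; lra.
have : 0 < g y by have := Hd (y - x); rewrite subrK; apply; lra.
by move=> gy; have : 0 < g y * (x + h - x); [rewrite mulr_gt0//; lra|lra].
Unshelve. all: by end_near.
Qed.

(** * Contact with the barrier [m * s^-k] along a line *)

Lemma is_derive_powR (R : realType) (g : R -> R) (a x dg : R) :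
  0 < g x -> is_derive x (1 : R) g dg ->
  is_derive x (1 : R) (fun y => g y `^ a) (a * g x `^ (a - 1) * dg).
Proof.
move=> gx0 gdg; have Dp := is_derive1_powR a gx0.
exact: (@is_derive1_comp _ (fun y => y `^ a) g x _ _ Dp gdg).
Qed.

Lemma is_derive_affine (R : realType) (s q x : R) :
  is_derive x (1 : R) (fun y => s + q * y) q.
Proof.
have D := is_deriveD (is_derive_cst s x (1 : R))
  (is_deriveZ q (is_derive_id x (1 : R))).
by rewrite add0r /GRing.scale/= mulr1 in D.
Qed.

Lemma is_derive_trinomial (R : realType) (s q c x : R) :
  is_derive x (1 : R) (fun y => s + q * y + c * y ^+ 2) (q + 2 * c * x).
Proof.
have D := is_deriveD (is_derive_affine s q x)
  (is_deriveZ c (is_deriveM (is_derive_id x (1 : R)) (is_derive_id x (1 : R)))).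
have e : q + c *: (id x *: (1 : R) + id x *: 1) = q + 2 * c * x.
  by rewrite /GRing.scale/=; ring.
rewrite e in D.
exact: D.
Qed.

Lemma near0_trinomial_gt0 (R : realType) (s q c : R) : 0 < s ->
  \forall y \near (0:R), 0 < s + q * y + c * y ^+ 2.
Proof.
move=> s0; have /derivable1_diffP/differentiable_continuous ct :
  derivable (fun y => s + q * y + c * y ^+ 2) 0 (1:R).
  by have [] := is_derive_trinomial s q c 0.
by apply: (cvgr_gt _ ct); rewrite mulr0 expr0n/= mulr0 !addr0.
Qed.

(** [F] touches [m * tri^-k] from below at 0, so the difference has a maximum there and its second
    derivative is nonpositive. The right side is the second derivative of the barrier, from
    [tri' = q] and [tri'' = 2 * c] at 0, with [s^(-k-2)] factored out. *)
Lemma barrier_second_derive_le (R : realType) (F g : R -> R) (s q c k m l : R) :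
  0 < s -> (forall r, is_derive r (1 : R) F (g r)) -> is_derive 0 (1 : R) g l ->
  F 0 * s `^ k = m ->
  (\forall r \near 0, F r * (s + q * r + c * r ^+ 2) `^ k <= m) ->
  l <= m * s `^ (- k - 2) * (k * (k + 1) * q ^+ 2 - 2 * k * c * s).
Proof.
move=> s0 DF Dg F0 Fm.
pose tri r := s + q * r + c * r ^+ 2.
have tri0 : tri 0 = s by rewrite /tri mulr0 expr0n/= mulr0 !addr0.
have Dtri r : is_derive r (1 : R) tri (q + 2 * c * r).
  exact: is_derive_trinomial.
pose psi : R -> R := m \*: (fun r => tri r `^ (- k)).
have psiE r : psi r = m * tri r `^ (- k) by [].
pose dpsi r : R := m *: (- k * tri r `^ (- k - 1) * (q + 2 * c * r)).
have Dpsi r : 0 < tri r -> is_derive r (1 : R) psi (dpsi r).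
  by move=> r0; exact: (is_deriveZ m (is_derive_powR (- k) r0 (Dtri r))).
have Ddpsi : is_derive 0 (1 : R) dpsi
    (m * s `^ (- k - 2) * (k * (k + 1) * q ^+ 2 - 2 * k * c * s)).
  have D1 := @is_derive_powR R tri (- k - 1) 0 _ _ (Dtri 0).
  rewrite {1}tri0 in D1; have {}D1 := D1 s0.
  have D := is_deriveZ m (is_deriveZ (- k)
    (is_deriveM D1 (is_derive_affine q (2 * c) 0))).
  have -> : dpsi = m \*: (- k \*: ((fun r => tri r `^ (- k - 1)) *
      (fun r => q + 2 * c * r))).
    by apply/funext => r; rewrite /dpsi !fctE /GRing.scale/= -!mulrA.
  apply: (is_derive_eq D).
  rewrite /GRing.scale/= tri0 mulr0 addr0.
  have -> : s `^ (- k - 1) = s * s `^ (- k - 2).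
    rewrite -{2}(powRr1 (ltW s0)) -powRD ?(gt_eqF s0) ?implybT//.
    by congr (_ `^ _); ring.
  have -> : - k - 1 - 1 = - k - 2 by ring.
  ring.
rewrite -subr_le0.
apply: (@max_second_derive_le0 _ (F - psi) (g - dpsi) 0).
- near=> r.
  have r0 : 0 < tri r by near: r; exact: near0_trinomial_gt0.
  exact: (is_deriveB (DF r) (Dpsi r r0)).
- have -> : (F - psi) 0 = 0.
    rewrite !fctE psiE tri0 -F0 -mulrA -powRD ?(gt_eqF s0) ?implybT//.
    by rewrite subrr powRr0 mulr1 subrr.
  near=> r; rewrite !fctE subr_le0 psiE powRN ler_pdivlMr.
    by near: r; exact: Fm.
  by apply: powR_gt0; near: r; exact: near0_trinomial_gt0.
Unshelve. all: by end_near.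
Qed.

(** Time counterpart: contact from below at earlier times only bounds the derivative of [F] by that
    of the barrier on one side. *)
Lemma barrier_derive_ge (R : realType) (F : R -> R) (t s b k m a : R) :
  0 < s -> is_derive t (1 : R) F a -> F t * s `^ k = m ->
  (\forall h \near (0 : R)^'-, F (h + t) * (s + b * h) `^ k <= m) ->
  m * s `^ (- k - 2) * (- (k * b * s)) <= a.
Proof.
move=> s0 DF F0 Fm.
pose tri r := s - b * t + b * r.
have tri0 : tri t = s by rewrite /tri subrK.
have Dtri : is_derive t (1 : R) tri b by exact: is_derive_affine.
pose psi : R -> R := m \*: (fun r => tri r `^ (- k)).
have psiE r : psi r = m * tri r `^ (- k) by [].
have Dpsi : is_derive t (1 : R) psi (m * s `^ (- k - 2) * (- (k * b * s))).
  have D1 := @is_derive_powR R tri (- k) t _ _ Dtri.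
  rewrite {1}tri0 in D1; have {}D1 := D1 s0.
  apply: (is_derive_eq (is_deriveZ m D1)).
  rewrite /GRing.scale/= tri0.
  have -> : s `^ (- k - 1) = s * s `^ (- k - 2).
    rewrite -{2}(powRr1 (ltW s0)) -powRD ?(gt_eqF s0) ?implybT//.
    by congr (_ `^ _); ring.
  ring.
rewrite -subr_ge0.
apply: (@left_max_derive_ge0 _ (F - psi) t).
have -> : (F - psi) t = 0.
  rewrite !fctE psiE tri0 -F0 -mulrA -powRD ?(gt_eqF s0) ?implybT//.
  by rewrite subrr powRr0 mulr1 subrr.
have tri_gt0 : \forall h \near (0:R)^'-, 0 < s + b * h.
  rewrite near_withinE; apply: filterS (near0_trinomial_gt0 b 0 s0) => h.
  by rewrite mul0r addr0.
near=> h; rewrite !fctE subr_le0 psiE /tri.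
have -> : s - b * t + b * (h + t) = s + b * h by ring.
rewrite powRN ler_pdivlMr.
  by near: h; exact: Fm.
by apply: powR_gt0; near: h.
Unshelve. all: by end_near.
Qed.

(** * The squared Euclidean norm, its restriction to coordinate lines, and compactness of balls *)

Section SquaredNorm.
Context {R : realType} {N : nat}.
Implicit Types x y : 'rV[R]_N.

Definition sqnorm x : R := \sum_(i < N) x ord0 i ^+ 2.

Lemma sqnorm_ge0 x : 0 <= sqnorm x.
Proof. by apply: sumr_ge0 => i _; exact: sqr_ge0. Qed.

Lemma enorm_sqr x : enorm x ^+ 2 = sqnorm x.
Proof. exact/sqr_sqrtr/sqnorm_ge0. Qed.

Lemma enorm_powR x (b : R) : enorm x `^ b = sqnorm x `^ (b / 2).
Proof.
by rewrite -[enorm x]powR12_sqrt ?sqnorm_ge0// -powRrM; congr (_ `^ _); lra.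
Qed.

Lemma sqnorm_gt0 x : x != 0 -> 0 < sqnorm x.
Proof.
move=> x0; rewrite lt_def sqnorm_ge0 andbT; apply: contra x0 => /eqP sx0.
apply/eqP/rowP => i; rewrite mxE; apply/eqP; rewrite -sqrf_eq0.
by move/eqP: sx0; rewrite psumr_eq0 => [/allP/(_ i)|j _];
  [rewrite mem_index_enum => /(_ isT)|exact: sqr_ge0].
Qed.

Lemma sqnorm0 : sqnorm 0 = 0.
Proof. by rewrite /sqnorm big1// => i _; rewrite mxE expr0n. Qed.

Lemma sqnorm_line x y (i : 'I_N) (r : R) :
  sqnorm (x + r *: evec R i - y)
  = sqnorm (x - y) + 2 * (x - y) ord0 i * r + r ^+ 2.
Proof.
have -> : x + r *: evec R i - y = (x - y) + r *: evec R i by rewrite addrAC.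
move: (x - y) => z; rewrite /sqnorm (bigD1 i)//= [in RHS](bigD1 i)//= !mxE !eqxx.
under eq_bigr => j ji do rewrite !mxE (negbTE ji) andbF mulr0 addr0.
by rewrite mulr1; ring.
Qed.

Lemma sqnormD_le x y : sqnorm (x + y) <= 2 * sqnorm x + 2 * sqnorm y.
Proof.
rewrite /sqnorm !mulr_sumr -big_split/=; apply: ler_sum => i _.
by rewrite !mxE; have := sqr_ge0 (x ord0 i - y ord0 i); nra.
Qed.

Lemma sqnormB x y : sqnorm (x - y) = sqnorm (y - x).
Proof. by apply: eq_bigr => i _; rewrite !mxE -sqrrN opprB. Qed.

Lemma continuous_sqnorm : continuous sqnorm.
Proof.
apply: continuous_big => [|i _].
  exact: add_continuous.
by have ci := @coord_continuous R 1 N ord0 i; move=> x; exact: (cvgM (ci x) (ci x)).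
Qed.

Lemma closed_sublevel (T : topologicalType) (f : T -> R) (r : R) :
  continuous f -> closed [set x | f x <= r].
Proof. by move=> cf; apply: preimage_closed (@closed_le _ r) => x _. Qed.

Lemma continuous_sqnormB y : continuous (fun x => sqnorm (x - y)).
Proof.
move=> x; apply: (@continuous_comp _ _ _ (fun x => x - y) sqnorm).
  exact: (@cvgB _ _ _ (nbhs x) _ id (cst y) x y cvg_id (cvg_cst y)).
exact: continuous_sqnorm.
Qed.

Lemma compact_sqnorm_ball y (r : R) : compact [set x | sqnorm (x - y) <= r].
Proof.
apply: bounded_closed_compact.
  (* The ambient norm is the sup norm, so coordinates suffice; [r + 1] dominates any [z] with
     [z ^+ 2 <= r] without a square root. *)
  exists (`|y| + (r + 1)); split; first exact: num_real.
  move=> M rM x /= xr.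
  apply: le_trans (ltW rM).
  have -> : x = y + (x - y) by rewrite addrC subrK.
  rewrite (le_trans (ler_normD _ _))// lerD2l.
  have r0 : 0 <= r := le_trans (sqnorm_ge0 _) xr.
  rewrite /Num.norm/= mx_normrE; apply: bigmax_le; first lra.
  move=> [i j] _ /=; rewrite (ord1 i).
  have : (x - y) ord0 j ^+ 2 <= r.
    apply: le_trans xr; rewrite /sqnorm (bigD1 j)//= lerDl.
    by apply: sumr_ge0 => *; exact: sqr_ge0.
  move: ((x - y) ord0 j) => z zr.
  by rewrite ler_norml; apply/andP; split; nra.
exact/closed_sublevel/continuous_sqnormB.
Qed.

End SquaredNorm.

(** * Existence of weighted maxima *)

Lemma continuous_powR_gt0 (R : realType) (k x : R) :
  0 < x -> {for x, continuous (fun y => y `^ k)}.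
Proof.
move=> x0; apply: differentiable_continuous; apply/derivable1_diffP.
by have [] := is_derive1_powR k x0.
Qed.

(* The weight kills w near its zero set, so the supremum over s > 0 is already
   taken over a compact set s >= eta. *)
Lemma weighted_max (R : realType) (T : topologicalType) (D : set T)
    (w s : T -> R) (k A : R) :
  compact D -> {in D, continuous w} -> continuous s -> 0 < k -> 0 < A ->
  (forall z, D z -> 0 < s z -> w z * s z `^ k <= A) \/
  exists z, [/\ D z, 0 < s z, A < w z * s z `^ k &
    forall z', D z' -> 0 < s z' -> w z' * s z' `^ k <= w z * s z `^ k].
Proof.
move=> cD cw cs k0 A0.
have [|] := pselect (exists z, [/\ D z, 0 < s z & A < w z * s z `^ k]); last first.
  move=> nz; left=> z Dz sz; rewrite leNgt; apply/negP => zA.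
  by apply: nz; exists z.
move=> [z [Dz sz zA]]; right.
have [B B0 wB] : exists2 B, 0 < B & forall z', D z' -> w z' <= B.
  have [||c Dc wc] := @compact_EVT_max T R w D _ cD.
  - by exists z.
  - exact: continuous_in_subspaceT.
  - exists (Num.max 1 (w c)); first by rewrite lt_max ltr01.
    by move=> z' Dz'; rewrite le_max wc ?orbT// inE.
(* The second entry solves [B * eta^k = A], so the product stays at most [A] where [s < eta]; the
   first keeps the point [z] in the compact set. *)
pose eta := Num.min (s z) ((A / B) `^ k^-1).
have eta0 : 0 < eta by rewrite lt_min sz powR_gt0// divr_gt0.
have etaB : B * eta `^ k <= A.
  have : eta `^ k <= A / B.
    have -> : A / B = ((A / B) `^ k^-1) `^ k.
      by rewrite -powRrM mulVf ?gt_eqF// powRr1// ltW// divr_gt0.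
    apply: ge0_ler_powR; rewrite ?nnegrE ?powR_ge0//; try exact: ltW.
    by rewrite ge_min lexx orbT.
  by rewrite ler_pdivlMr// mulrC.
have cD' : compact (D `&` [set z' | eta <= s z']).
  apply: compact_closedI => //.
  by apply: preimage_closed (@closed_ge _ eta) => x _; exact: cs.
have cws : {within D `&` [set z' | eta <= s z'],
    continuous (fun z' => w z' * s z' `^ k)}.
  apply: continuous_in_subspaceT => x; rewrite inE => -[Dx sx].
  apply: cvgM; first by apply: cw; rewrite inE.
  apply: (@continuous_comp _ _ _ s (fun y => y `^ k)); first exact: cs.
  by apply: continuous_powR_gt0; exact: lt_le_trans sx.
have [|c] := @compact_EVT_max T R _ _ _ cD' cws.
  by exists z; split => //=; rewrite ge_min lexx.
rewrite inE => -[Dc sc] maxc.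
have zc : w z * s z `^ k <= w c * s c `^ k.
  by apply: maxc; rewrite inE; split => //=; rewrite ge_min lexx.
exists c; split => //.
- exact: lt_le_trans sc.
- exact: lt_le_trans zc.
- move=> z' Dz' sz'; have [se|es] := leP eta (s z').
    by apply: maxc; rewrite inE.
  apply: le_trans (le_trans _ etaB) (le_trans (ltW zA) zc).
  apply: (@le_trans _ _ (B * s z' `^ k)).
    by rewrite ler_wpM2r ?powR_ge0// wB.
  rewrite ler_wpM2l ?(ltW B0)//.
  by apply: ge0_ler_powR; rewrite ?nnegrE ?ltW.
Qed.

(** * Comparison with barriers at an interior maximum *)

Section Comparison.
Context {R : realType} {N : nat}.
Implicit Types (w : 'rV[R]_N -> R -> R) (x y : 'rV[R]_N).

(** The derivatives are data attached to restrictions of [w] to coordinate lines, the form in which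
    the one-variable tests apply. *)
Definition heat_jet w x (t a : R) (l : 'I_N -> R) : Prop :=
  is_derive t (1 : R) (w x) a /\
  exists g : 'I_N -> R -> R, forall i,
    (forall r, is_derive r (1 : R) (fun r => w (x + r *: evec R i) t) (g i r)) /\
    is_derive 0 (1 : R) (g i) (l i).

(** One family covers both barriers and also the function that cuts out the paraboloid. *)
Definition barrier_base (a0 b c : R) y (z : 'rV[R]_N * R) : R :=
  a0 + b * z.2 + c * sqnorm (z.1 - y).

Lemma continuous_barrier_base a0 b c y : continuous (barrier_base a0 b c y).
Proof.
move=> z.
have c1 : (fun z : 'rV[R]_N * R => b * z.2) @ z --> b * z.2.
  by apply: cvgM; [exact: cvg_cst|exact: cvg_snd].
have c2 : (fun z : 'rV[R]_N * R => sqnorm (z.1 - y)) @ z --> sqnorm (z.1 - y).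
  apply: (@continuous_comp _ _ _ fst (fun x => sqnorm (x - y))).
    exact: cvg_fst.
  exact: continuous_sqnormB.
exact: (cvgD (cvgD (cvg_cst a0) c1) (cvgM (cvg_cst c) c2)).
Qed.

(** The left side is the heat operator applied to [M * s^-k], where [M] is the maximal value of
    [w * s^k]; hence [M * s^(-k-2)] becomes [w / s^2]. The bracket uses |grad s|^2 = 4 c^2 |x - y|^2
    and Laplacian(s) = 2 c N. *)
Lemma heat_jet_barrier w x t a (l : 'I_N -> R) (D : set ('rV[R]_N * R))
    (a0 b c k : R) y (s := barrier_base a0 b c y) :
  heat_jet w x t a l -> 0 < s (x, t) ->
  (forall i, \forall r \near (0 : R), D (x + r *: evec R i, t)) ->
  (\forall h \near (0 : R)^'-, D (x, h + t)) ->
  (forall z, D z -> 0 < s z ->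
    w z.1 z.2 * s z `^ k <= w x t * s (x, t) `^ k) ->
  w x t / s (x, t) ^+ 2 *
    - (k * b * s (x, t) + 4 * k * (k + 1) * c ^+ 2 * sqnorm (x - y)
       - 2 * k * c * N%:R * s (x, t))
  <= a - \sum_(i < N) l i.
Proof.
move=> [Da [g Hg]] s0 Dx Dt maxw.
have se : w x t * s (x, t) `^ k * s (x, t) `^ (- k - 2) = w x t / s (x, t) ^+ 2.
  rewrite -mulrA -powRD ?(gt_eqF s0) ?implybT//; congr (_ * _).
  have -> : k + (- k - 2) = - 2 by ring.
  by rewrite powRN powR_mulrn// ltW.
have ta : w x t / s (x, t) ^+ 2 * (- (k * b * s (x, t))) <= a.
  rewrite -se; apply: (@barrier_derive_ge _ (w x) t (s (x, t)) b k) => //.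
  have sb h : s (x, h + t) = s (x, t) + b * h.
    by rewrite /s /barrier_base/=; ring.
  have sgt0 : \forall h \near (0:R)^'-, 0 < s (x, t) + b * h.
    rewrite near_withinE; apply: filterS (near0_trinomial_gt0 b 0 s0) => h.
    by rewrite mul0r addr0.
  near=> h; rewrite -sb; apply: (maxw (x, h + t)); first by near: h.
  by rewrite sb; near: h.
have tl i : l i <= w x t / s (x, t) ^+ 2 *
    (k * (k + 1) * (c * (2 * (x - y) ord0 i)) ^+ 2 - 2 * k * c * s (x, t)).
  have [gi li] := Hg i.
  have sq r : s (x + r *: evec R i, t)
      = s (x, t) + (c * (2 * (x - y) ord0 i)) * r + c * r ^+ 2.
    by rewrite /s /barrier_base/= sqnorm_line; ring.
  rewrite -se.
  apply: (barrier_second_derive_le (s0) gi li); first by rewrite scale0r addr0.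
  near=> r; rewrite -sq; apply: (maxw (x + r *: evec R i, t)).
    by near: r; exact: Dx.
  by rewrite sq; near: r; exact: near0_trinomial_gt0.
have : \sum_(i < N) l i <= w x t / s (x, t) ^+ 2 *
    (k * (k + 1) * 4 * c ^+ 2 * sqnorm (x - y)
     - 2 * k * c * N%:R * s (x, t)).
  apply: le_trans (ler_sum _ (fun i _ => tl i)) _.
  rewrite -mulr_sumr sumrB sumr_const card_ord.
  rewrite [X in _ * (X - _)](_ : _ = k * (k + 1) * 4 * c ^+ 2 * sqnorm (x - y)).
    by rewrite -mulr_natr le_eqVlt; apply/orP; left; apply/eqP; ring.
  by rewrite /sqnorm mulr_sumr; apply: eq_bigr => i _; ring.
move: ta; set W := w x t / _; set S := \sum_(i < N) l i; lra.
Unshelve. all: by end_near.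
Qed.

(** If the bound failed, the maximum of [w * s^k] would exceed [A], and the strict inequality
    assumed there would contradict the contact inequality. Boundary data enter by showing that
    points above the level [A] are off the parabolic boundary. *)
Lemma barrier_comparison w (D : set ('rV[R]_N * R)) (a0 b c k A : R) y
    (s := barrier_base a0 b c y) :
  compact D -> {in D, continuous (fun z => w z.1 z.2)} -> 0 < k -> 0 < A ->
  (forall x t, D (x, t) -> 0 < s (x, t) -> A < w x t * s (x, t) `^ k ->
    [/\ forall i, \forall r \near (0 : R), D (x + r *: evec R i, t),
        \forall h \near (0 : R)^'-, D (x, h + t) &
        exists a l, heat_jet w x t a l /\
          a - \sum_(i < N) l i < w x t / s (x, t) ^+ 2 *
            - (k * b * s (x, t) + 4 * k * (k + 1) * c ^+ 2 * sqnorm (x - y)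
               - 2 * k * c * N%:R * s (x, t))]) ->
  forall x t, D (x, t) -> 0 < s (x, t) -> w x t * s (x, t) `^ k <= A.
Proof.
move=> cD cw k0 A0 H x t Dxt sxt.
have [|[[x1 t1] [D1 s1 A1 max1]]] :=
    weighted_max cD cw (@continuous_barrier_base a0 b c y) k0 A0.
  by move/(_ (x, t)); apply.
have [Dx Dt [a [l [J]]]] := H _ _ D1 s1 A1.
by rewrite ltNge (heat_jet_barrier J s1 Dx Dt max1).
Qed.

End Comparison.

(** * From solutions to subsolutions *)

Lemma is_derive_line (R : realType) (V : normedModType R) (f : V -> R) (x v : V)
    (r : R) :
  derivable f (x + r *: v) v ->
  is_derive r (1 : R) (fun r => f (x + r *: v)) ('D_v f (x + r *: v)).
Proof.
move=> df.
have e : (fun h : R => h^-1 *: (((fun r => f (x + r *: v)) \o shift r) (h *: 1)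
      - f (x + r *: v)))
    = (fun h : R => h^-1 *: ((f \o shift (x + r *: v)) (h *: v)
      - f (x + r *: v))).
  apply/funext => h /=; congr (_ *: (f _ - _)).
  by rewrite [h%:A]mulr1 scalerDl addrCA.
apply: DeriveDef; first by rewrite /derivable e.
by rewrite /derive e.
Qed.

Lemma near_line (R : realType) (N : nat) (x v : 'rV[R]_N) (t : R)
    (P : set ('rV[R]_N * R)) :
  (\forall z \near (x, t), P z) -> \forall r \near (0 : R), P (x + r *: v, t).
Proof.
have : (fun r : R => x + r *: v) @ (0 : R) --> x + 0 *: v.
  exact: (cvgD (cvg_cst x) (cvgZ cvg_id (cvg_cst v))).
by rewrite scale0r addr0 => c; exact: (cvg_pair c (cvg_cst t)).
Qed.

Lemma near_time (R : realType) (N : nat) (x : 'rV[R]_N) (t : R)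
    (P : set ('rV[R]_N * R)) :
  (\forall z \near (x, t), P z) -> \forall h \near (0 : R), P (x, h + t).
Proof.
have : (fun h : R => h + t) @ (0 : R) --> 0 + t.
  exact: (cvgD cvg_id (cvg_cst t)).
by rewrite add0r => c; exact: (cvg_pair (cvg_cst x) c).
Qed.

Section Subsolution.
Context {R : realType} {N : nat}.
Implicit Types (u w : 'rV[R]_N -> R -> R) (x y : 'rV[R]_N).

(* The inequality a - \sum_i l i <= 0 is also required at x = 0, where for
   beta < 0 the equation is not imposed: it holds there by continuity. *)
Definition subsolution (T p beta : R) w : Prop :=
  [/\ {in QT T, continuous (fun z : 'rV[R]_N * R => w z.1 z.2)},
      forall x t, QT T (x, t) -> 0 < w x t -> exists a l,
        [/\ heat_jet w x t a l, a - \sum_(i < N) l i <= 0 &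
            x != 0 -> a - \sum_(i < N) l i <= - (enorm x `^ beta * w x t `^ p)] &
      vanishes_initially T w].

Lemma solution_heat_jet T u (e : R) x t : C21 T u -> QT T (x, t) ->
  heat_jet (fun x t => e * u x t) x t (e * dt u x t)
    (fun i => e * dx i (dx i u) x t).
Proof.
move=> [_ [Dt _] [Dx _] [Dxx _]] xt; split.
  have D : is_derive t (1 : R) (u x) (dt u x t).
    by apply: DeriveDef; [exact: Dt|].
  exact: (is_deriveZ e D).
exists (fun i r => e * dx i u (x + r *: evec R i) t) => i; split.
  move=> r; have D := is_derive_line (Dx i (x + r *: evec R i) t xt).
  exact: (is_deriveZ e D).
have D0 : derivable (fun y => dx i u y t) (x + 0 *: evec R i) (evec R i).
  by rewrite scale0r addr0; exact: Dxx.
have := is_deriveZ e (is_derive_line D0).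
by rewrite scale0r addr0.
Qed.

(** This carries the sign of the heat operator over to x = 0, where the equation may not be
    imposed. *)
Lemma continuous_heat T u (e : R) : C21 T u ->
  {in QT T, continuous (fun z : 'rV[R]_N * R =>
    e * dt u z.1 z.2 - \sum_(i < N) e * dx i (dx i u) z.1 z.2)}.
Proof.
move=> [_ [_ ct] _ [_ cxx]] z zQ.
apply: (@cvgB _ _ _ (nbhs z)).
  by apply: cvgM; [exact: cvg_cst|exact: ct].
apply: cvg_big => [|i _]; first exact: add_continuous.
by apply: cvgM; [exact: cvg_cst|exact: cxx].
Qed.

(** The absorption is odd in [u], so both signs of [e] give the same equation; where [e * u] is
    positive it equals |u|. *)
Lemma solution_heat_eq T p beta u (e : R) x t :
  0 < p -> `|e| = 1 -> solution T p beta u -> QT T (x, t) ->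
  (0 <= beta \/ x != 0) -> 0 < e * u x t ->
  e * dt u x t - \sum_(i < N) e * dx i (dx i u) x t
  = - (enorm x `^ beta * (e * u x t) `^ p).
Proof.
move=> p0 e1 [_ eq] xt bx w0; have := eq x t xt bx.
have -> : `|u x t| = e * u x t.
  by rewrite -[RHS]gtr0_norm// normrM e1 mul1r.
rewrite -mulr_sumr -mulrBr -/(laplacian u x t) => E.
rewrite -(mulr_powRB1 (ltW w0) p0).
apply/eqP; rewrite -subr_eq0 opprK; apply/eqP.
transitivity (e * 0); last exact: mulr0.
rewrite -E; ring.
Qed.

Lemma solution_subsolution T p beta u (e : R) : (1 <= N)%N -> 0 < p ->
  `|e| = 1 -> solution T p beta u -> vanishes_initially T u ->
  subsolution T p beta (fun x t => e * u x t).
Proof.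
move=> N1 p0 e1 su vu; have [C _] := su.
have cw : {in QT T, continuous (fun z : 'rV[R]_N * R => e * u z.1 z.2)}.
  by move=> z zQ; apply: cvgM; [exact: cvg_cst|case: C => + _ _ _; apply].
split => //.
- move=> x t xt w0.
  exists (e * dt u x t), (fun i => e * dx i (dx i u) x t).
  have neg y : y != 0 -> 0 < e * u y t ->
      e * dt u y t - \sum_(i < N) e * dx i (dx i u) y t <= 0.
    move=> y0 wy; rewrite (solution_heat_eq p0 e1 su)//; last by right.
    by rewrite oppr_le0 mulr_ge0// powR_ge0.
  split; first exact: solution_heat_jet C xt.
    (* At the origin, a positive heat operator and a positive [w] would persist at nearby points of
       a coordinate axis, which exists as [N] is positive; the nonzero ones contradict [neg]. *)
    have [x0|] := eqVneq x 0; last by move/neg; apply.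
    rewrite leNgt; apply/negP => f0.
    have xtQ : (x, t) \in QT T by rewrite inE.
    pose v := evec R (Ordinal N1).
    have F0 := cvgr_gt _ (continuous_heat (e := e) C xtQ) _ f0.
    have W0 := cvgr_gt _ (cw _ xtQ) _ w0.
    have {}F0 := near_line v (F0 _).
    have {}W0 := near_line v (W0 _).
    near (0 : R)^' => r.
    have r0 : r != 0 by near: r; exact: nbhs_dnbhs_neq.
    have : x + r *: v != 0.
      rewrite x0 add0r scaler_eq0 negb_or r0/=; apply/eqP.
      move/rowP/(_ (Ordinal N1)); rewrite !mxE !eqxx => /eqP.
      by rewrite oner_eq0.
    move=> /neg; rewrite leNgt => /(_ _)/negP; apply.
      by near: r; exact: nbhs_dnbhs (W0 _).
    by near: r; exact: nbhs_dnbhs (F0 _).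
  move=> x0; rewrite (solution_heat_eq p0 e1 su)//; by right.
- move=> x x0.
  have := cvgM (cvg_cst e) (vu x x0); rewrite mulr0; exact.
Unshelve. all: by end_near.
Qed.

End Subsolution.

(** * Bounds away from the origin, then near it *)

(** The initial limit is joint in space and time, so each point of [K] has a neighbourhood with its
    own time span; compactness gives a common one. *)
Lemma compact_vanishes (R : realType) (N : nat) (T : R)
    (w : 'rV[R]_N -> R -> R) (K : set 'rV[R]_N) (e : R) :
  vanishes_initially T w -> compact K -> (forall x, K x -> x != 0) -> 0 < e ->
  exists2 d, 0 < d & forall x t, K x -> 0 < t < d -> t < T -> w x t <= e.
Proof.
move=> vw cK K0 e0.
have /nbhs_ballP[d/= d0 Hd] : \forall t \near (0 : R),
    K `<=` (fun x => 0 < t < T -> w x t <= e).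
  have cov := (compact_near_coveringP K).1 cK R (nbhs (0 : R))
    (fun t x => 0 < t < T -> w x t <= e) _.
  apply: cov => x Kx.
  have : \forall z \near (x, 0 : R), 0 < z.2 < T -> w z.1 z.2 <= e.
    have := cvgr_le _ (vw x (K0 x Kx)) _ e0.
    exact.
  exact.
exists d => // x t Kx /andP[t0 td] tT; apply: (Hd t) => //; last by rewrite t0.
by rewrite /ball/= sub0r normrN gtr0_norm.
Qed.

(** Compares the weight on a ball with its value at the centre; the absolute value in the exponent
    treats both signs of [b] at once. *)
Lemma powR_ratio_ge (R : realType) (b x y : R) :
  0 < y -> y / 4 <= x -> x <= 4 * y -> y `^ b / 4 `^ `|b| <= x `^ b.
Proof.
move=> y0 xy yx; have x0 : 0 < x by apply: lt_le_trans xy; rewrite divr_gt0.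
rewrite ler_pdivrMr ?powR_gt0//; have [b0|b0] := leP 0 b.
  rewrite ger0_norm// -powRM ?(ltW x0)//.
  by apply: ge0_ler_powR; rewrite ?nnegrE//; lra.
rewrite ltr0_norm//; have := b0; rewrite -oppr_gt0.
have {2 3}-> : b = - (- b) by rewrite opprK.
move: (- b) => c c0; rewrite !powRN mulrC ler_pdivlMr ?powR_gt0//.
rewrite mulrC ler_pdivrMr ?powR_gt0// -powRM ?(ltW y0)//.
by apply: ge0_ler_powR; rewrite ?nnegrE; lra.
Qed.

(* Barrier blowing up on the sphere of radius |x0| / 2 around x0: the exponent
   k = 2 / (p - 1) balances the Laplacian against the absorption. *)
Lemma subsolution_spatial_bound (R : realType) (N : nat) (p beta : R) :
  1 < p ->
  exists2 C, 0 < C & forall (T : R) (w : 'rV[R]_N -> R -> R),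
    subsolution T p beta w -> forall x t, QT T (x, t) -> x != 0 ->
    w x t <= C / sqnorm x `^ ((2 + beta) / (2 * (p - 1))).
Proof.
move=> p1; have q0 : 0 < p - 1 by rewrite subr_gt0.
pose k := 2 / (p - 1).
have k0 : 0 < k by rewrite divr_gt0.
have kq : k * (p - 1) = 2 by rewrite divfK ?gt_eqF.
(* With [b = 0] and [c = -1], both |x - x0|^2 and [s] are at most [X / 4], so [Ck * (X / 4)] bounds
   the barrier bracket. *)
pose Ck := 4 * k * (k + 1) + 2 * k * N%:R.
have Ck0 : 0 < Ck.
  rewrite ltr_wpDr//; last by rewrite mulr_gt0 ?addr_gt0// mulr_gt0.
  by rewrite mulr_ge0// mulr_ge0// ltW.
pose M : R := 4 `^ `|beta / 2|.
have M0 : 0 < M by apply: powR_gt0.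
(* Tuned so that the lower bound [X^(beta/2) / M] of the weight times [G * X^(1 - beta/2)] is
   exactly [Ck * (X / 4)]. *)
pose G := Ck * M / 4.
have G0 : 0 < G by rewrite divr_gt0// mulr_gt0.
exists (G `^ (p - 1)^-1 * 4 `^ k); first by rewrite mulr_gt0 ?powR_gt0.
move=> T w [cw sw vw] x0 t0 t0Q x00; have /andP[/= t00 t0T] := t0Q.
pose X := sqnorm x0.
have X0 : 0 < X by exact: sqnorm_gt0.
pose A := (G * X `^ (1 - beta / 2)) `^ (p - 1)^-1.
have GX0 : 0 < G * X `^ (1 - beta / 2) by rewrite mulr_gt0 ?powR_gt0.
have A0 : 0 < A by rewrite powR_gt0.
have Aq : A `^ (p - 1) = G * X `^ (1 - beta / 2).
  by rewrite -powRrM mulVf ?gt_eqF// powRr1// ltW.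
pose K := [set x | sqnorm (x - x0) <= X / 4].
have cK : compact K by exact: compact_sqnorm_ball.
have Kle x : K x -> X / 4 <= sqnorm x /\ sqnorm x <= 4 * X.
  rewrite /K/= => Kx; split.
    have := sqnormD_le x (x0 - x); rewrite addrC subrK (sqnormB x0) -/X; lra.
  have := sqnormD_le x0 (x - x0); rewrite addrC subrK -/X; lra.
have K0 x : K x -> x != 0.
  move=> /Kle[Xx _]; apply/eqP => xE.
  by move: Xx; rewrite xE sqnorm0; lra.
have r0 : 0 < X / 4 by rewrite divr_gt0.
have [d d0 Hd] := compact_vanishes vw cK K0
  (divr_gt0 A0 (powR_gt0 k r0)).
(* Starting time of the cylinder: positive, before [t0], and early enough for the uniform initial
   smallness. *)
pose d' := Num.min d t0 / 2.
have [d'0 d'd d't] : [/\ 0 < d', d' < d & d' < t0].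
  have : 0 < Num.min d t0 by rewrite lt_min d0.
  have : Num.min d t0 <= d by rewrite ge_min lexx.
  have : Num.min d t0 <= t0 by rewrite ge_min lexx orbT.
  by rewrite /d'; split; lra.
pose D := K `*` [set` `[d', t0]].
have cD : compact D by apply: compact_setX => //; exact: segment_compact.
have DQ z : D z -> z \in QT T.
  by move=> [_]; rewrite /= in_itv/= inE /QT/= => /andP[? ?]; lra.
have sE x t : barrier_base (X / 4) 0 (- 1) x0 (x, t) = X / 4 - sqnorm (x - x0).
  by rewrite /barrier_base/=; ring.
have : w x0 t0 * barrier_base (X / 4) 0 (- 1) x0 (x0, t0) `^ k <= A.
  apply: (barrier_comparison cD _ k0 A0).
  - by move=> z; rewrite inE => /DQ; exact: cw.
  - move=> x t Dxt; rewrite sE; have [/= Kx] := Dxt.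
    rewrite in_itv/= => /andP[td tt0].
    set s := X / 4 - _ => s0 As.
    have sX : s <= X / 4 by rewrite gerBl sqnorm_ge0.
    have w0 : 0 < w x t.
      by have := lt_trans A0 As; rewrite pmulr_lgt0// powR_gt0.
    (* On the bottom, [w <= A / (X / 4)^k] and [s <= X / 4] keep the product at most [A]. *)
    have td' : d' < t.
      rewrite lt_neqAle td andbT; apply/eqP => tE.
      move: As; rewrite ltNge => /negP; apply.
      have : w x t <= A / (X / 4) `^ k by apply: Hd => //; lra.
      rewrite ler_pdivlMr ?powR_gt0//; apply: le_trans.
      rewrite ler_wpM2l ?(ltW w0)//.
      by apply: ge0_ler_powR; rewrite ?nnegrE ?(ltW k0) ?(ltW s0) ?(ltW r0).
    have xtQ : QT T (x, t) by have := DQ _ Dxt; rewrite inE.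
    split.
    (* Positivity of [s] means that [x] is inside the open ball, so the lateral boundary never
       occurs. *)
    + move=> i.
      have : 0 < barrier_base (X / 4) 0 (- 1) x0 (x, t) by rewrite sE.
      move/(cvgr_gt _ (@continuous_barrier_base _ _ (X / 4) 0 (- 1) x0 (x, t))).
      move=> /(near_line (evec R i)); apply: filterS => r.
      rewrite sE subr_gt0 => rK.
      by split; [rewrite /K/= ltW|rewrite /= in_itv/= td].
    + near=> h; split => //=; rewrite in_itv/= -lerBlDr.
      apply/andP; split.
        by near: h; apply: nbhs_left_ge; rewrite subr_lt0.
      apply: le_trans tt0; rewrite gerDr.
      by near: h; exact: nbhs_left_le.
    + have [a [l [J _ le]]] := sw _ _ xtQ w0.
      exists a, l; split => //; apply: le_lt_trans (le (K0 _ Kx)) _.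
      pose P := w x t `^ (p - 1).
      (* The contact level raised to the power [p - 1]; [k * (p - 1) = 2] turns [s^k] into the [s^2]
         of the barrier inequality. *)
      have P1 : G * X `^ (1 - beta / 2) < P * s ^+ 2.
        have -> : P * s ^+ 2 = (w x t * s `^ k) `^ (p - 1).
          rewrite powRM ?powR_ge0 ?(ltW w0)// -powRrM kq.
          by rewrite powR_mulrn// ltW.
        by rewrite -Aq; apply: gt0_ltr_powR; rewrite ?nnegrE ?(ltW A0)//
          mulr_ge0 ?powR_ge0// ltW.
      have P2 : X `^ (beta / 2) / M <= enorm x `^ beta.
        by have [? ?] := Kle _ Kx; rewrite enorm_powR; exact: powR_ratio_ge.
      have P3 : Ck * (X / 4) < enorm x `^ beta * (P * s ^+ 2).
        apply: (@lt_le_trans _ _ (X `^ (beta / 2) / M * (P * s ^+ 2))).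
          have e : X `^ (beta / 2) * X `^ (1 - beta / 2) = X.
            rewrite -powRD ?(gt_eqF X0) ?implybT//.
            by rewrite addrC subrK powRr1// ltW.
          have -> : Ck * (X / 4) = X `^ (beta / 2) / M * (G * X `^ (1 - beta / 2)).
            by rewrite /G -[in LHS]e; field; rewrite gt_eqF.
          by rewrite ltr_pM2l// divr_gt0 ?powR_gt0.
        by rewrite ler_wpM2r// mulr_ge0 ?powR_ge0// sqr_ge0.
      have P4 : k * 0 * s + 4 * k * (k + 1) * (- 1) ^+ 2 * sqnorm (x - x0)
          - 2 * k * - 1 * N%:R * s <= Ck * (X / 4).
        have : k * N%:R * s <= k * N%:R * (X / 4).
          by rewrite ler_wpM2l// mulr_ge0 ?(ltW k0).
        have : k * (k + 1) * sqnorm (x - x0) <= k * (k + 1) * (X / 4).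
          by rewrite ler_wpM2l// mulr_ge0 ?addr_ge0 ?(ltW k0).
        by rewrite /Ck; lra.
      move: (le_lt_trans P4 P3); set E := _ - 2 * _ * _ * _ * _ => PE.
      rewrite mulrN ltrN2 -mulrAC ltr_pdivrMr ?exprn_gt0//.
      rewrite -(mulr_powRB1 (ltW w0) (lt_trans ltr01 p1)) -/P.
      have -> : enorm x `^ beta * (w x t * P) * s ^+ 2
        = w x t * (enorm x `^ beta * (P * s ^+ 2)) by ring.
      by rewrite ltr_pM2l.
  - by split; [rewrite /K/= subrr sqnorm0 ltW|rewrite /= in_itv/= (ltW d't) lexx].
  - by rewrite sE subrr sqnorm0 subr0.
rewrite sE subrr sqnorm0 subr0 -ler_pdivlMr ?powR_gt0// => /le_trans; apply.
(* Equality holds by homogeneity: the powers of [X] combine as (1 - beta/2)/(p - 1) - k = -(2 +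
   beta)/(2(p - 1)). *)
rewrite le_eqVlt; apply/orP; left; apply/eqP.
have -> : A = G `^ (p - 1)^-1 * X `^ ((1 - beta / 2) * (p - 1)^-1).
  by rewrite powRrM -powRM ?powR_ge0 ?(ltW G0).
have -> : (X / 4) `^ k = X `^ k / 4 `^ k.
  have {2}-> : X = X / 4 * 4 by rewrite divfK.
  by rewrite [in RHS]powRM ?(ltW r0)// mulfK// gt_eqF// powR_gt0.
rewrite -/X invfM invrK -!mulrA; congr (_ * _).
rewrite mulrA mulrC -!powRN -powRD ?(gt_eqF X0) ?implybT//.
congr (_ * _ `^ _); rewrite /k; field; lra.
Unshelve. all: by end_near.
Qed.

(* In the paraboloids |x|^2 < xi (t - t0 / 2) the heat equation alone makes
   (t - t0 / 2 + |x|^2)^-gamma a strict supersolution; their lateral boundary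
   stays away from x = 0, where the spatial bound applies. *)
Lemma subsolution_parabolic_bound (R : realType) (N : nat) (p beta : R) :
  (1 <= N)%N -> 1 < p -> -2 < beta ->
  exists C : R, forall (T : R) (w : 'rV[R]_N -> R -> R),
    subsolution T p beta w -> forall x t, QT T (x, t) ->
    w x t <= C / (sqnorm x + t) `^ ((2 + beta) / (2 * (p - 1))).
Proof.
move=> N1 p1 b2.
have [C1 C10 spatial] := @subsolution_spatial_bound R N p beta p1.
set ga := (2 + beta) / _ in spatial *.
have ga0 : 0 < ga by rewrite divr_gt0//; lra.
(* Makes the gradient term at most [s / 2] in the paraboloid, so that [s + s / 2 < 2 * N * s]
   decides the sign. *)
pose xi := (8 * (ga + 1))^-1.
have xi0 : 0 < xi by rewrite invr_gt0; lra.
have xiE : 4 * (ga + 1) * xi = 2^-1 by rewrite /xi; field; lra.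
have powle a b : 0 < a -> a <= b -> a `^ ga <= b `^ ga.
  move=> a0 ab; apply: ge0_ler_powR; rewrite ?nnegrE ?(ltW ga0) ?(ltW a0)//.
  exact: le_trans (ltW a0) ab.
(* On the lateral boundary [s = (1 + xi^-1) * |x|^2], so the spatial bound gives exactly this
   level. *)
pose A := C1 * (1 + xi^-1) `^ ga.
have xiV0 : 0 < xi^-1 by rewrite invr_gt0.
have A0 : 0 < A by rewrite mulr_gt0// powR_gt0//; lra.
(* The first summand serves points inside the paraboloid, where |x0|^2 + t0 is at most twice [s];
   the second serves those outside. *)
exists (A * 2 `^ ga + C1 * (1 + 2 * xi^-1) `^ ga) => T w sw x0 t0 t0Q.
have [cw sw' _] := sw.
have /andP[/= t00 t0T] := t0Q.
have S0 : 0 < sqnorm x0 + t0 by rewrite ltr_wpDl// sqnorm_ge0.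
rewrite ler_pdivlMr ?powR_gt0//.
have [far|near] := leP (xi * (t0 / 2)) (sqnorm x0).
  have X0 : 0 < sqnorm x0 by apply: lt_le_trans far; rewrite mulr_gt0// divr_gt0.
  have x00 : x0 != 0.
    by apply/eqP => xE; move: X0; rewrite xE sqnorm0 ltxx.
  have := spatial _ _ sw _ _ t0Q x00; rewrite ler_pdivlMr ?powR_gt0// => wX.
  have Sle : sqnorm x0 + t0 <= (1 + 2 * xi^-1) * sqnorm x0.
    have : t0 / 2 <= sqnorm x0 / xi by rewrite ler_pdivlMr// mulrC.
    by lra.
  have [w0|w0] := leP (w x0 t0) 0.
    apply: (@le_trans _ _ 0); first by rewrite mulr_le0_ge0 ?powR_ge0.
    by rewrite addr_ge0// mulr_ge0 ?powR_ge0// ltW.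
  apply: (@le_trans _ _ (C1 * (1 + 2 * xi^-1) `^ ga)); last first.
    by rewrite lerDr mulr_ge0 ?powR_ge0// ltW.
  apply: (@le_trans _ _ (w x0 t0 * ((1 + 2 * xi^-1) * sqnorm x0) `^ ga)).
    by rewrite ler_wpM2l ?(ltW w0)// powle.
  rewrite powRM ?sqnorm_ge0//; last lra.
  by rewrite mulrCA mulrC ler_wpM2r ?powR_ge0.
pose ta := t0 / 2.
have ta0 : 0 < ta by rewrite divr_gt0.
have tat0 : ta < t0 by rewrite /ta; lra.
pose f := barrier_base (xi * ta) (- xi) 1 (0 : 'rV[R]_N).
have fE x t : f (x, t) = sqnorm x - xi * (t - ta).
  by rewrite /f /barrier_base/= subr0; ring.
(* The cylinder supplies compactness and the closed condition [f <= 0] cuts out the paraboloid, with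
   vertex [(0, ta)]. *)
pose D := ([set x | sqnorm (x - 0) <= xi * t0] `*` [set` `[ta, t0]])
  `&` [set z | f z <= 0].
have cD : compact D.
  apply: compact_closedI; last exact/closed_sublevel/continuous_barrier_base.
  by apply: compact_setX; [exact: compact_sqnorm_ball|exact: segment_compact].
have DP x t : D (x, t) <-> [/\ ta <= t, t <= t0 & sqnorm x <= xi * (t - ta)].
  rewrite /D/= fE in_itv/= subr0 subr_le0; split.
    by move=> [[_ /andP[? ?]] ?].
  move=> [t1 t2 xt]; split => //; split; last by rewrite t1.
  by apply: le_trans xt _; rewrite ler_pM2l//; lra.
have sE x t : barrier_base (- ta) 1 1 0 (x, t) = t - ta + sqnorm x.
  by rewrite /barrier_base/= subr0; ring.
have : w x0 t0 * barrier_base (- ta) 1 1 0 (x0, t0) `^ ga <= A.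
  apply: (barrier_comparison cD _ ga0 A0).
  - move=> [x t]; rewrite inE => /DP[t1 t2 _]; apply: cw.
    by rewrite inE /QT/=; apply/andP; split; lra.
  - move=> x t /DP[t1 t2 xt]; rewrite sE subr0 => s0 As.
    have w0 : 0 < w x t.
      by have := lt_trans A0 As; rewrite pmulr_lgt0// powR_gt0.
    have xtQ : QT T (x, t) by rewrite /QT/=; apply/andP; split; lra.
    (* At time [ta] the paraboloid is reduced to its vertex, where [s] vanishes; no initial data
       enter. *)
    have t1' : ta < t.
      rewrite ltNge; apply/negP => tle.
      have tE : t = ta by apply/eqP; rewrite eq_le tle.
      by move: xt s0; rewrite tE subrr mulr0 add0r => /le_lt_trans h /h; rewrite ltxx.
    have f0 : f (x, t) < 0.
      rewrite fE subr_lt0 lt_neqAle xt andbT; apply/eqP => xE.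
      have X0 : 0 < sqnorm x by rewrite xE mulr_gt0// subr_gt0.
      have x00 : x != 0.
        by apply/eqP => e; move: X0; rewrite e sqnorm0 ltxx.
      have := spatial _ _ sw _ _ xtQ x00; rewrite ler_pdivlMr ?powR_gt0// => wX.
      move: As; rewrite ltNge => /negP; apply.
      have -> : t - ta + sqnorm x = (1 + xi^-1) * sqnorm x.
        by rewrite mulrDl mul1r addrC {3}xE mulKf// gt_eqF.
      rewrite powRM ?sqnorm_ge0//; last lra.
      by rewrite mulrCA /A mulrC ler_wpM2r ?powR_ge0.
    have fnear := cvgr_lt _ (@continuous_barrier_base _ _ (xi * ta) (- xi) 1 0
      (x, t)) _ f0.
    have {}fnear : \forall z \near (x, t), f z < 0 by exact: fnear.
    split.
    + move=> i; have := near_line (evec R i) fnear; apply: filterS => r.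
      by rewrite fE subr_lt0 => /ltW fr; apply/DP.
    + have fr := near_time fnear.
      near=> h; apply/DP; split.
      * by rewrite -lerBlDr; near: h; apply: nbhs_left_ge; rewrite subr_lt0.
      * by apply: le_trans t2; rewrite gerDr; near: h; exact: nbhs_left_le.
      * rewrite -subr_le0 -fE; apply: ltW; near: h.
        by rewrite near_withinE; apply: filterS fr => h.
    (* Only the heat inequality is kept, since it also holds at x = 0. *)
    + have [a [l [J le _]]] := sw' _ _ xtQ w0.
      exists a, l; split => //; apply: le_lt_trans le _.
      rewrite mulr_gt0 ?divr_gt0 ?exprn_gt0// oppr_gt0.
      set s := t - ta + _ in s0 *.
      have N1' : s <= N%:R * s by rewrite ler_peMl ?(ltW s0)// ler1n.
      have : 4 * (ga + 1) * sqnorm x <= 4 * (ga + 1) * (xi * (t - ta)).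
        by rewrite ler_pM2l//; lra.
      rewrite [leRHS]mulrA xiE => sx.
      have -> : ga * 1 * s + 4 * ga * (ga + 1) * 1 ^+ 2 * sqnorm x
          - 2 * ga * 1 * N%:R * s
          = ga * (s + 4 * (ga + 1) * sqnorm x - 2 * (N%:R * s)) by ring.
      rewrite pmulr_rlt0//.
      have := sqnorm_ge0 x; rewrite {}/s in s0 N1' *; lra.
  - by apply/DP; split; [exact: ltW|exact: lexx|rewrite /ta; lra].
  - by rewrite sE; have := sqnorm_ge0 x0; lra.
rewrite sE => wA.
have [w0|w0] := leP (w x0 t0) 0.
  apply: (@le_trans _ _ 0); first by rewrite mulr_le0_ge0 ?powR_ge0.
  by rewrite addr_ge0// mulr_ge0 ?powR_ge0// ltW.
apply: (@le_trans _ _ (A * 2 `^ ga)); last first.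
  by rewrite lerDl mulr_ge0 ?powR_ge0// ltW.
apply: (@le_trans _ _ (w x0 t0 * ((t0 - ta + sqnorm x0) * 2) `^ ga)).
  rewrite ler_wpM2l ?(ltW w0)// powle//.
  by have := sqnorm_ge0 x0; rewrite /ta; lra.
rewrite powRM//; first by rewrite mulrA ler_wpM2r ?powR_ge0.
by have := sqnorm_ge0 x0; lra.
Unshelve. all: by end_near.
Qed.

Theorem proposition2p4 (R : realType) (N : nat) (p beta : R)
    (hN : (1 <= N)%N) (hp : 1 < p) (hbeta : -2 < beta) :
  exists c : R, forall (T : R) (u : 'rV[R]_N -> R -> R),
    0 < T ->
    solution T p beta u ->
    vanishes_initially T u ->
    forall (x : 'rV[R]_N) (t : R), QT T (x, t) ->
      `|u x t| <= c / (enorm x ^+ 2 + t) `^ ((2 + beta) / (2 * (p - 1))).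
Proof.
have [c Hc] := subsolution_parabolic_bound hN hp hbeta.
have p0 : 0 < p by lra.
exists c => T u _ su vu x t xtQ; rewrite enorm_sqr ler_norml.
have s1 := solution_subsolution hN p0 (normr1 R) su vu.
have n1 : `|-1| = 1 :> R by rewrite normrN1.
have s2 := solution_subsolution hN p0 n1 su vu.
have := Hc _ _ s1 _ _ xtQ; have := Hc _ _ s2 _ _ xtQ.
by rewrite mulN1r mul1r lerNl => -> ->.
Qed.
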